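(* Let $\varepsilon>0$ and let $k\in\mathbb N$, $k\le s$, satisfy $k\ge \dim^{\rm trnc}(\varepsilon)$. Let $A_{k,n}$ be an algorithm using $n$ function values for approximating $\mathcal S(f)$ for $f\in\mathcal F_k$, and let $\mathcal A^{\rm trnc}_{s,k,n}(f)=A_{k,n}(f_k)$ for $f\in\mathcal F$. Then $$e(\mathcal A^{\rm trnc}_{s,k,n};\mathcal F)\le\left(\varepsilon^{p^*}+e(A_{k,n};\mathcal F_k)^{p^*}\right)^{1/p^*}.$$
   Context: Setting. $s\in\mathbb N\cup\{\infty\}$; $[s]=\{1,\dots,s\}$ if $s<\infty$ and $[\infty]=\mathbb N=\{1,2,\dots\}$; $\mathfrak u,\mathfrak v$ always denote finite subsets of $[s]$. $D\subseteq\mathbb R$ is a (possibly unbounded) interval with $0\in D$. $p\in[1,\infty]$ and $p^*$ is its conjugate, $1/p+1/p^*=1$. $\boldsymbol\gamma=(\gamma_{\mathfrak u})_{\mathfrak u\subseteq[s]}$ are positive weights. $\mathcal F$ is a normed linear space of functions on $D^s$, such that each $f\in\mathcal F$ has a unique decomposition $f=\sum_{\mathfrak u\subseteq[s]}f_{\mathfrak u}$ with $f_{\mathfrak u}\in F_{\mathfrak u}$, where the $F_{\mathfrak u}\subseteq\mathcal F$ are normed linear spaces with $F_{\mathfrak u}\cap F_{\mathfrak v}=\{0\}$ for $\mathfrak u\ne\mathfrak v$, $f_{\mathfrak u}$ depends only on $\boldsymbol x_{\mathfrak u}=(x_j)_{j\in\mathfrak u}$, and $f_{\mathfrak u}(\boldsymbol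 x)=0$ if $x_j=0$ for some $j\in\mathfrak u$. $F_\emptyset$ is the space of constant functions normed by the absolute value. The norm of $\mathcal F$ is $$\|f\|_{\mathcal F}=\Big(\sum_{\mathfrak u\subseteq[s]}\gamma_{\mathfrak u}^{-p}\|f_{\mathfrak u}\|_{F_{\mathfrak u}}^p\Big)^{1/p}$$ (supremum of $\gamma_{\mathfrak u}^{-1}\|f_{\mathfrak u}\|_{F_{\mathfrak u}}$ if $p=\infty$). If $s=\infty$, the series for $f$ converges in the norm of $\mathcal F$; it need not converge pointwise, in which case $f$ is identified with the sequence $(f_{\mathfrak u})_{\mathfrak u}$. For $k\in\mathbb N$, $k\le s$, $f_k(\boldsymbol x)=f(x_1,\dots,x_k,0,0,\dots)$, equivalently $f_k=\sum_{\mathfrak u\subseteq[k]}f_{\mathfrak u}$. $\mathcal S:\mathcal F\to\mathcal G$ is a continuous linear operator into a normed linear space $\mathcal G$. Truncation error: $\mathrm{err}^{\rm trnc}(k)=\sup_{f\in\mathcal F}\frac{\|\mathcal S(f-f_k)\|_{\mathcal G}}{\|f-f_k\|_{\mathcal F}}$. Truncation dimension: $\dim^{\rm trnc}(\varepsilon)=\min\{k:\mathrm{err}^{\rm trnc}(k)\le\varepsilon\}$. $\mathcal F_k=\bigoplus_{\mathfrak u\subseteq[k]}F_{\mathfrak u}\subseteq\mathcal F$, the subspace of $k$-variate functions $f_k$, with the norm of $\mathcal F$. An algorithm $A_{k,n}$ using $n$ function values is a mapping $\mathcal F_k\to\mathcal G$ whose output on $f$ depends on $f$ only through $n$ function values.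 Worst case errors: $$e(A_{k,n};\mathcal F_k)=\sup_{f\in\mathcal F_k}\frac{\|\mathcal S(f)-A_{k,n}(f)\|_{\mathcal G}}{\|f\|_{\mathcal F_k}},\qquad e(\mathcal A^{\rm trnc}_{s,k,n};\mathcal F)=\sup_{f\in\mathcal F}\frac{\|\mathcal S(f)-\mathcal A^{\rm trnc}_{s,k,n}(f)\|_{\mathcal G}}{\|f\|_{\mathcal F}}.$$ Conventions: in suprema of quotients, $0/0=0$ and $c/0=+\infty$ for $c>0$; $\min\emptyset=\infty$; for $p^*=\infty$ the expression $(a^{p^*}+b^{p^*})^{1/p^*}$ means $\max(a,b)$. *)

(* Defs.v *)
From HB Require Import structures.
From mathcomp Require Import all_boot all_order all_algebra finmap.
From mathcomp Require Import all_classical all_reals all_analysis.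
Import Order.TTheory GRing.Theory Num.Theory.
Import numFieldNormedType.Exports.

Set Implicit Arguments.
Unset Strict Implicit.
Unset Printing Implicit Defensive.

Local Open Scope classical_set_scope.
Local Open Scope ring_scope.

(* [None] stands for infinity. *)
Definition natinf := option nat.

Definition le_natinf (k : nat) (s : natinf) : bool :=
  if s is Some m then (k <= m)%N else true.

Definition natinf_le (s : natinf) (k : nat) : bool :=
  if s is Some m then (m <= k)%N else false.

(* {1, ..., s}, or {1, 2, ...} if s is infinite *)
Definition coordinate (s : natinf) := {j : nat | (0 < j)%N && le_natinf j s}.

Definition initseg (s : natinf) (k : nat) : {fset coordinate s} :=
  [fset j in pmap (insub : nat -> option (coordinate s)) (iota 1 k)]%fset.

Lemma in_initseg (s : natinf) (k : nat) (j : coordinate s) :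
  (j \in initseg s k) = (val j <= k)%N.
Proof.
rewrite in_fset /= mem_pmap_sub /= mem_iota add1n ltnS.
by case: j => j /= /andP[-> _].
Qed.

Definition cube_point (R : realType) (s : natinf) (D : interval R) :=
  coordinate s -> {x : R | x \in D}.

(* F_u, u a finite subset of [s], is [sector u], whose elements represent
   functions on D^s through [ev]; [incl] is the inclusion of F_u in F.  An
   element f of F is known through its family [part f] of components f_u, as is
   necessary when s is infinite and the series need not converge pointwise.
   Convergence of the series is along the directed set of finite sets of
   indices u; for finite s it is a finite sum and the condition an equality. *)
Section AnchoredSpace.
Context (R : realType) (s : natinf) (D : interval R).
Context (p : \bar R) (gamma : {fset coordinate s} -> R).

Definition decomposes (F : normedModType R)
    (FU : {fset coordinate s} -> normedModType R)
    (incl : forall u, {linear FU u -> F}) (f : F) (g : forall u, FU u) :=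
  forall e : R, 0 < e -> exists U : {fset {fset coordinate s}},
    forall V : {fset {fset coordinate s}}, (U `<=` V)%fset ->
      `|f - \sum_(u <- V) incl u (g u)| < e.

Definition weighted_norm (FU : {fset coordinate s} -> normedModType R)
    (g : forall u, FU u) : \bar R :=
  match p with
  | r%:E => ((\esum_(u in [set: {fset coordinate s}])
                (gamma u `^ (- r) * `|g u| `^ r)%:E) `^ r^-1)%E
  | +oo%E => ereal_sup (range (fun u => ((gamma u)^-1 * `|g u|)%:E))
  | -oo%E => 0%E
  end.

Record anchored_space := AnchoredSpace {
  carrier :> normedModType R ;
  sector : {fset coordinate s} -> normedModType R ;
  ev : forall u, {linear sector u -> (cube_point s D -> R^o)} ;
  incl : forall u, {linear sector u -> carrier} ;
  part : carrier -> forall u, sector u ;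
  ev_inj : forall u, injective (ev u) ;
  ev_depends : forall u (g : sector u) (x y : cube_point s D),
    (forall j, j \in u -> x j = y j) -> ev u g x = ev u g y ;
  ev_anchored : forall u (g : sector u) (x : cube_point s D) (j : coordinate s),
    j \in u -> val (x j) = 0 -> ev u g x = 0 ;
  ev0_const : forall c : R, exists g : sector fset0, forall x, ev fset0 g x = c ;
  ev0_norm : forall (g : sector fset0) x, `|g| = `|ev fset0 g x| ;
  incl_inj : forall u, injective (incl u) ;
  incl_disjoint : forall u v (g : sector u) (h : sector v),
    u != v -> incl u g = incl v h -> incl u g = 0 ;
  part_decomposes : forall f, decomposes incl f (part f) ;
  part_unique : forall f g, decomposes incl f g -> forall u, g u = part f u ;
  carrier_norm : forall f, `|f|%:E = weighted_norm (part f)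
}.

End AnchoredSpace.

Section Truncation.
Context (R : realType) (s : natinf) (D : interval R).
Context (p : \bar R) (gamma : {fset coordinate s} -> R).
Context (X : anchored_space D p gamma).

Definition truncation (k : nat) (f : X) : X :=
  \sum_(u <- fpowerset (initseg s k)) incl X u (part f u).

(* F_k *)
Definition kvariate (k : nat) : set X :=
  [set f | exists g : forall u, sector X u,
     f = \sum_(u <- fpowerset (initseg s k)) incl X u (g u)].

(* f_k(x), which is f(x) when f is in F_k, or when s is finite and s <= k. *)
Definition trunc_eval (k : nat) (f : X) (x : cube_point s D) : R :=
  \sum_(u <- fpowerset (initseg s k)) ev X u (part f u) x.

Definition anchor (D0 : 0 \in D) (k : nat) (x : cube_point s D) :
    cube_point s D :=
  fun j => if (val j <= k)%N then x j else exist (fun z => z \in D) 0 D0.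

(* f_k(x) = f(x_1, ..., x_k, 0, 0, ...) *)
Lemma trunc_eval_anchor (D0 : 0 \in D) (k m : nat) (f : X)
    (x : cube_point s D) :
  (k <= m)%N -> trunc_eval m f (anchor D0 k x) = trunc_eval k f x.
Proof.
move=> km; rewrite /trunc_eval.
rewrite (bigID (fun u => u `<=` initseg s k)%fset) /= [X in _ + X]big1 ?addr0; last first.
  move=> u /fsubsetPn[j ju]; rewrite in_initseg => /negbTE jk.
  by apply: (@ev_anchored _ _ _ _ _ X u _ _ j) => //; rewrite /anchor jk.
rewrite -big_filter (perm_big (fpowerset (initseg s k))) /=; last first.
  apply: uniq_perm; rewrite ?filter_uniq ?fset_uniq// => u.
  rewrite mem_filter !fpowersetE; apply: andb_idr => uk.
  apply: (fsubset_trans uk); apply/fsubsetP => j; rewrite !in_initseg => jk.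
  exact: leq_trans jk km.
apply: eq_big_seq => u; rewrite fpowersetE => /fsubsetP uk.
apply: ev_depends => j /uk; rewrite in_initseg /anchor => -> //.
Qed.

End Truncation.

Section Errors.
Context (R : realType) (s : natinf) (D : interval R).
Context (p : \bar R) (gamma : {fset coordinate s} -> R).
Context (X : anchored_space D p gamma) (G : normedModType R).
Local Open Scope ereal_scope.

(* a / b for a, b >= 0, with 0 / 0 = 0 and c / 0 = +oo for c > 0 *)
Definition equot (a b : R) : \bar R :=
  if b == 0%R then (if a == 0%R then 0 else +oo) else (a / b)%:E.

Definition err_trnc (S : {linear X -> G}) (k : nat) : \bar R :=
  ereal_sup [set equot `|S (f - truncation k f)%R| `|(f - truncation k f)%R|
            | f in [set: X]].

Definition trnc_admissible (S : {linear X -> G}) (eps : R) (k : nat) : bool :=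
  [&& (0 < k)%N, le_natinf k s & err_trnc S k <= eps%:E].

Definition dim_trnc (S : {linear X -> G}) (eps : R) : natinf :=
  if pselect (exists k, trnc_admissible S eps k) is left h
  then Some (ex_minn h) else None.

Definition worst_case_error (S : {linear X -> G}) (T : set X) (A : X -> G) :
    \bar R :=
  ereal_sup [set equot `|(S f - A f)%R| `|f| | f in T].

(* The list of the first n values of f in F_k seen by an algorithm which picks
   each sample point on the basis of the values seen so far; with a strategy
   [t] depending only on the length of its argument, this is sampling at n
   points fixed in advance. *)
Fixpoint samples (k : nat) (t : seq R -> cube_point s D) (n : nat)
    (f : X) : seq R :=
  if n is m.+1 then
    let y := samples k t m f in rcons y (trunc_eval k f (t y))
  else [::].

(* Only the values of A on F_k matter. *)
Definition uses_values (k n : nat) (A : X -> G) :=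
  exists (t : seq R -> cube_point s D) (phi : seq R -> G),
    forall f, kvariate k f -> A f = phi (samples k t n f).

Definition trnc_algorithm (k : nat) (A : X -> G) : X -> G :=
  fun f => A (truncation k f).

(* (a^q + b^q)^(1/q), for q in [1, +oo] and a, b >= 0 *)
Definition lq_pair (q a b : \bar R) : \bar R :=
  match q with
  | r%:E => (a `^ r + b `^ r) `^ r^-1
  | +oo => maxe a b
  | -oo => 0
  end.

End Errors.

(* Main.v *)
Require Import Defs.
From HB Require Import structures.
From mathcomp Require Import all_boot all_order all_algebra finmap.
From mathcomp Require Import all_classical all_reals all_analysis.
Import Order.TTheory GRing.Theory Num.Theory.
Import numFieldNormedType.Exports.
Local Open Scope classical_set_scope.
Local Open Scope ring_scope.

(* Split S f - A f_k into S (f - f_k), of norm at most eps |f - f_k|, and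
   S f_k - A f_k, of norm at most e |f_k| where e is the error of A on F_k, and
   apply Hoelder's inequality for two terms.  The components of f_k and f - f_k
   are those of f with u in, resp. not in, [k], so that
   |f - f_k|^p + |f_k|^p = |f|^p (a maximum if p is infinite). *)

Section LqPair.
Context {R : realType}.
Implicit Types (p : \bar R) (a b : R).
Local Open Scope ereal_scope.

Lemma lq_pair_ge0 p (x y : \bar R) : 0 <= x -> 0 <= lq_pair p x y.
Proof. by case: p => [r| |] //= x0; rewrite ?poweR_ge0// le_max x0. Qed.

Lemma lq_pairEFin r a b :
  lq_pair r%:E a%:E b%:E = ((a `^ r + b `^ r) `^ r^-1)%R%:E.
Proof. by []. Qed.

Lemma lq_pair1 a b : (0 <= a)%R -> (0 <= b)%R ->
  lq_pair 1 a%:E b%:E = (a + b)%R%:E.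
Proof. by move=> a0 b0; rewrite lq_pairEFin invr1 !powRr1 ?addr_ge0. Qed.

Lemma lq_pair_fin_num p a b : lq_pair p a%:E b%:E \is a fin_num.
Proof. by case: p => [r| |]//=; rewrite -?EFin_max// lq_pairEFin. Qed.

(** For an algorithm of infinite error on F_k, whose bound is then trivial. An exponent [r >= 1] has
    [r] and [r^-1] nonzero, so both powers of [+oo] are [+oo]. *)
Lemma lq_pairy p a : 1 <= p -> (0 <= a)%R -> lq_pair p a%:E +oo = +oo.
Proof.
case: p => [r| |] r1 a0; rewrite /lq_pair//; last by rewrite max_r// leey.
have r0 : r != 0%R by rewrite gt_eqF// (lt_le_trans ltr01).
by rewrite poweR_EFin poweRyr// addey// poweRyr// invr_eq0.
Qed.

Lemma lq_pair_hoelder p a1 a2 b1 b2 : 1 <= p ->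
  (0 <= a1)%R -> (0 <= a2)%R -> (0 <= b1)%R -> (0 <= b2)%R ->
  (a1 * b1 + a2 * b2)%R%:E <=
    lq_pair (hoelder_conjugate p) a1%:E a2%:E * lq_pair p b1%:E b2%:E.
Proof.
move=> + a10 a20 b10 b20.
(* The endpoint case: for p = 1 and p = +oo one pair is measured by its maximum and the other by its
   sum. *)
have maxl (x1 x2 y1 y2 : R) : (0 <= x1 -> 0 <= x2 -> 0 <= y1 -> 0 <= y2 ->
    x1 * y1 + x2 * y2 <= Num.max x1 x2 * (y1 + y2))%R.
  by move=> *; rewrite mulrDr lerD// ler_wpM2r// le_max lexx ?orbT.
case: p => [r| |]//; last first.
  move=> _; rewrite hoelder_conjugatey lq_pair1//= -EFin_max -EFinM lee_fin.
  by rewrite [leRHS]mulrC (mulrC a1) (mulrC a2) maxl.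
rewrite lee_fin le_eqVlt => /predU1P[<-|r1].
  by rewrite hoelder_conjugate1 lq_pair1//= -EFin_max -EFinM lee_fin maxl.
have r0 : (0 < r)%R by rewrite (lt_trans ltr01).
have r10 : (0 < r - 1)%R by rewrite subr_gt0.
have -> : hoelder_conjugate r%:E = (r / (r - 1))%R%:E.
  by rewrite /hoelder_conjugate/= eqe gt_eqF// -EFinD inver gt_eqF// -EFinM.
rewrite !lq_pairEFin -EFinM lee_fin hoelder2 ?divr_gt0//.
(* The exponents are conjugate: (r - 1)/r + 1/r = 1. *)
by rewrite invf_div -{2}[r^-1%R]mul1r -mulrDl subrK divff// gt_eqF.
Qed.

End LqPair.

Section TruncationNorm.
Context {R : realType} {s : natinf} {D : interval R} {p : \bar R}.
Context {gamma : {fset coordinate s} -> R} {X : anchored_space D p gamma}.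
Implicit Types (f : X) (k : nat) (u : {fset coordinate s}).

(** The partial sums of the truncated family are constant once [V] contains all subsets of [k]; this
    is the convergence that [part_unique] asks for. *)
Lemma sum_incl_truncation k f (V : {fset {fset coordinate s}}) :
  (fpowerset (initseg s k) `<=` V)%fset ->
  \sum_(u <- V)
    Defs.incl X u (if u \in fpowerset (initseg s k) then part f u else 0) =
  truncation k f.
Proof.
move=> sub; rewrite -(big_fset_incl _ sub) /=; last first.
  by move=> u _ /negbTE ->; rewrite raddf0.
by apply: eq_big_seq => u ->.
Qed.

Lemma part_truncation k f u :
  part (truncation k f) u =
  if u \in fpowerset (initseg s k) then part f u else 0.
Proof.
apply/esym; move: u; apply: part_unique => e e0.
by exists (fpowerset (initseg s k)) => V /sum_incl_truncation ->;
  rewrite subrr normr0.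
Qed.

Lemma part_subr_truncation k f u :
  part (f - truncation k f) u =
  if u \in fpowerset (initseg s k) then 0 else part f u.
Proof.
apply/esym; move: u; apply: part_unique => e e0.
have [U HU] := part_decomposes f e0.
(* Adding the subsets of [k] to [U] lets f_k be written as a sum over [V] too; the remainder at [V]
   is then exactly that of [f]. *)
exists (U `|` fpowerset (initseg s k))%fset => V; rewrite fsubUset.
move=> /andP[/HU fV /(@sum_incl_truncation k f) <-].
rewrite -addrA -opprD -big_split /=.
rewrite (eq_bigr (fun u => Defs.incl X u (part f u)))//.
by move=> u _; case: ifPn => _; rewrite -raddfD ?addr0 ?add0r.
Qed.

Lemma truncation_subr_truncation k l f : (k <= l)%N ->
  truncation k (f - truncation l f) = 0.
Proof.
move=> kl; rewrite /truncation big1_seq// => u /=.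
rewrite part_subr_truncation !fpowersetE => /fsubset_trans ->.
  exact: raddf0.
by apply/fsubsetP => j; rewrite !in_initseg => /leq_trans; exact.
Qed.

Lemma kvariate_truncation k f : kvariate k (truncation k f).
Proof. by exists (part f). Qed.

End TruncationNorm.

Section AnchoredNorm.
Context {R : realType} {s : natinf} {D : interval R}.
Context {gamma : {fset coordinate s} -> R}.

(** The r-th power makes the norm additive over components. Stated in the extended reals, it also
    yields the finiteness of the sum. *)
Lemma powR_carrier_norm (r : R) (X : anchored_space D r%:E gamma) (f : X) :
  0 < r ->
  (\esum_(u in [set: {fset coordinate s}])
    (gamma u `^ (- r) * `|part f u| `^ r)%:E)%E = (`|f| `^ r)%:E.
Proof.
move=> r0; rewrite -poweR_EFin carrier_norm /weighted_norm.
rewrite -poweRrM mulVf ?gt_eqF// poweRe1// esum_ge0// => u _.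
by rewrite lee_fin mulr_ge0 ?powR_ge0.
Qed.

Lemma truncation_norm_le (p : \bar R) (X : anchored_space D p gamma)
    (k : nat) (f : X) : (1 <= p)%E -> (forall u, 0 < gamma u) ->
  (lq_pair p `|f - truncation k f|%:E `|truncation k f|%:E <= `|f|%:E)%E.
Proof.
move=> + gamma0; case: p X f => [r| |]// X f.
- rewrite lee_fin => r1; have r0 : 0 < r := lt_le_trans ltr01 r1.
  (* For finite p equality holds: [|f|] is written as (|f|^r)^(1/r), and the r-th powers are
     compared. *)
  rewrite lq_pairEFin lee_fin -[leRHS](@powRr1 R)//.
  rewrite -(@mulfV _ r) ?gt_eqF// powRrM le_eqVlt; apply/orP; left.
  apply/eqP; congr (_ `^ _); apply: EFin_inj.
  rewrite EFinD -!(powR_carrier_norm _ _ _ r0) -esumD; first last.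
  - by move=> u _; rewrite lee_fin mulr_ge0 ?powR_ge0.
  - by move=> u _; rewrite lee_fin mulr_ge0 ?powR_ge0.
  apply: eq_esum => u _; rewrite part_truncation part_subr_truncation.
  (* Each u contributes to exactly one of the two sums, since 0^r = 0 for r > 0. *)
  by case: ifP => _; rewrite normr0 powR0 ?gt_eqF// mulr0 ?adde0 ?add0e.
(* For p = +oo the norm is monotone in the norms of the components. *)
- move=> _; have le_part (g : X) : (forall u, `|part g u| <= `|part f u|) ->
      (`|g|%:E <= `|f|%:E)%E.
    move=> gf; rewrite !carrier_norm /weighted_norm.
    apply: ge_ereal_sup => _ [u _ <-].
    apply: (@le_trans _ _ ((gamma u)^-1 * `|part f u|)%:E).
      by rewrite lee_fin ler_wpM2l// invr_ge0 ltW.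
    by apply: ereal_sup_ubound; exists u.
  rewrite /= ge_max !le_part// => u.
  + by rewrite part_truncation; case: ifP => _; rewrite ?normr0.
  + by rewrite part_subr_truncation; case: ifP => _; rewrite ?normr0.
Qed.

End AnchoredNorm.

Section Errors.
Context {R : realType} {s : natinf} {D : interval R} {p : \bar R}.
Context {gamma : {fset coordinate s} -> R} {X : anchored_space D p gamma}.
Context {G : normedModType R}.
Implicit Types (S : {linear X -> G}) (k l : nat) (A : X -> G).
Local Open Scope ereal_scope.

(** Clears the denominator. If b = 0, the quotient is 0 or [+oo], so the bound forces a = 0, and c
    >= 0 has to be required separately. *)
Lemma equot_le (a b c : R) : (0 <= a)%R -> (0 <= b)%R ->
  (equot a b <= c%:E) = (a <= c * b)%R && ((b == 0%R) ==> (0 <= c)%R).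
Proof.
rewrite /equot => a0 b0; have [->|b_neq0] := eqVneq b 0%R.
  rewrite mulr0 [(a <= 0)%R]le_eqVlt ltNge a0 orbF.
  by case: eqVneq => _ /=; rewrite ?lee_fin// leNgt ltry.
by rewrite andbT lee_fin ler_pdivrMr// lt_def b_neq0.
Qed.

Lemma equot_ge0 (a b : R) : (0 <= a)%R -> (0 <= b)%R -> 0 <= equot a b.
Proof.
by rewrite /equot => a0 b0; case: ifP => _;
  [case: ifP | rewrite lee_fin divr_ge0].
Qed.

(** Nonemptiness matters because the supremum of the empty set is [-oo]. *)
Lemma worst_case_error_ge0 S (T : set X) A : T !=set0 ->
  0 <= worst_case_error S T A.
Proof.
move=> [f Tf]; apply: (@le_trans _ _ (equot `|S f - A f|%R `|f|)).
  exact: equot_ge0.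
by apply: ereal_sup_ubound; exists f.
Qed.

Lemma equot_worst_case_error S (T : set X) A f : T f ->
  equot `|S f - A f|%R `|f| <= worst_case_error S T A.
Proof. by move=> Tf; apply: ereal_sup_ubound; exists f. Qed.

(* [h := f - f_l] satisfies [h - h_k = h] for [k <= l]. *)
Lemma err_trnc_le S k l : (k <= l)%N -> err_trnc S l <= err_trnc S k.
Proof.
move=> kl; apply: ge_ereal_sup => _ [f _ <-].
apply: ereal_sup_ubound; exists (f - truncation l f)%R => //.
by rewrite truncation_subr_truncation// subr0.
Qed.

(** The minimum defining [dim_trnc] is attained, and monotonicity of the truncation error carries
    the bound to every larger k. *)
Lemma err_trnc_dim_trnc S (eps : R) k :
  natinf_le (dim_trnc S eps) k -> err_trnc S k <= eps%:E.
Proof.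
rewrite /dim_trnc; case: pselect => // h /=; case: ex_minnP => l.
by move=> /and3P[_ _ /(le_trans _) err_l] _ /(err_trnc_le S)/err_l.
Qed.

End Errors.

Theorem theorem3 (R : realType) (s : natinf) (D : interval R) (D0 : 0 \in D)
    (p : \bar R) (hp : (1 <= p)%E)
    (gamma : {fset coordinate s} -> R) (gamma_gt0 : forall u, 0 < gamma u)
    (X : anchored_space D p gamma) (G : normedModType R)
    (S : {linear X -> G}) (S_cont : continuous S)
    (eps : R) (eps_gt0 : 0 < eps)
    (k : nat) (k_gt0 : (0 < k)%N) (k_le_s : le_natinf k s)
    (k_ge_dim : natinf_le (dim_trnc S eps) k)
    (n : nat) (A : X -> G) (A_values : uses_values k n A) :
  (worst_case_error S [set: X] (trnc_algorithm k A)
   <= lq_pair (hoelder_conjugate p) eps%:E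
        (worst_case_error S (kvariate k) A))%E.
Proof.
set e := worst_case_error S (kvariate k) A.
have e_ge0 : (0 <= e)%E.
  by apply: worst_case_error_ge0; exists (truncation k 0);
    exact: kvariate_truncation.
have q1 : (1 <= hoelder_conjugate p)%E by exact: hoelder_conj_ge1.
have [eoo|] := eqVneq e +oo%E; first by rewrite eoo lq_pairy ?leey// ltW.
rewrite -ltey => e_lty.
have /fineK eE : e \is a fin_num by rewrite ge0_fin_numE.
have c0 : 0 <= fine e by rewrite fine_ge0.
rewrite -eE; move: c0 eE; set c := fine e => c0 eE.
(* With [e] finite the claimed bound is a nonnegative real, as [equot_le] needs; its sign settles
   the case |f| = 0. *)
have /fineK lE := lq_pair_fin_num (hoelder_conjugate p) eps c.
have l0 : 0 <= fine (lq_pair (hoelder_conjugate p) eps%:E c%:E).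
  by rewrite fine_ge0// lq_pair_ge0// lee_fin ltW.
rewrite -lE; apply: ge_ereal_sup => _ [f _ <-].
rewrite equot_le// l0 implybT andbT.
have trnc_le : `|S (f - truncation k f)| <= eps * `|f - truncation k f|.
  have : (equot `|S (f - truncation k f)|%R `|f - truncation k f|%R
          <= eps%:E)%E.
    apply: le_trans (err_trnc_dim_trnc S eps k k_ge_dim).
    by apply: ereal_sup_ubound; exists f.
  by rewrite equot_le// => /andP[].
have alg_le : `|S (truncation k f) - A (truncation k f)|
              <= c * `|truncation k f|.
  have := equot_worst_case_error S _ A _ (kvariate_truncation k f).
  by rewrite -/e -eE equot_le// => /andP[].
apply: (@le_trans _ _ (eps * `|f - truncation k f| + c * `|truncation k f|)).
  (* Only [S] is split by linearity; [A] may be nonlinear and is evaluated at f_k alone. *)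
  rewrite /trnc_algorithm -{1}(subrK (truncation k f) f) linearD -addrA.
  by rewrite (le_trans (ler_normD _ _))// lerD.
rewrite -lee_fin EFinM lE.
apply: le_trans (lq_pair_hoelder p _ _ _ _ hp (ltW eps_gt0) c0 _ _) _ => //.
apply: lee_wpmul2l; first by rewrite -lE lee_fin.
exact: truncation_norm_le.
Qed.
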